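(* Let $N\ge 1$, let $K=\bigcup_{\ell=1}^L[a_\ell,b_\ell]$ with $-1=a_1<b_1<a_2<b_2<\cdots<a_L<b_L=1$, and let $w=\Sigma/\Omega$, where $\Sigma$ and $\Omega$ are real polynomials that are positive on each $[a_\ell,b_\ell]$. Put $M=\max\{\deg(\Sigma),\deg(\Omega)+N\}$, and write $\Sigma=\sum_{m=0}^M\sigma_mT_m$. Let $\mathbf{W}\in\mathbb{R}^{(M+1)\times(N+1)}$ be the matrix of the linear map sending the Chebyshev coefficients $\mathbf{p}=(p_0,\dots,p_N)$ of a polynomial $P=\sum_{n=0}^Np_nT_n$ to the Chebyshev coefficients of $\Omega P=\sum_{m=0}^M(\mathbf{W}\mathbf{p})_mT_m$. For $\ell=1,\dots,L$ let $$\alpha_\ell=\tfrac12\exp\left(\tfrac{i}{2}\arccos(a_\ell)+\tfrac{i}{2}\arccos(b_\ell)\right),\qquad \beta_\ell=\cos\left(\tfrac12\arccos(a_\ell)-\tfrac12\arccos(b_\ell)\right),$$ where $i$ in the exponential is the imaginary unit. Then the $N$th Chebyshev polynomial (of the first kind) $\mathcal{T}_N^{K,w}$ for $K$ with weight $w$ has Chebyshev coefficients $p_0,p_1,\dots,p_N$ (i.e. $\mathcal{T}_N^{K,w}=\sum_{n=0}^Np_nT_n$) that solve the following semidefinite program, i.e. they are the $(p_0,\dots,p_N)$-component of a minimizer: minimize $c$ over $c,p_0,\dots,p_N\in\mathbb{R}$ and over Hermitian matrices $\mathbf{Q}^{+,\ell},\mathbf{Q}^{-,\ell}\in\mathbb{C}^{(M+1)\times(M+1)}$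 and $\mathbf{R}^{+,\ell},\mathbf{R}^{-,\ell}\in\mathbb{C}^{M\times M}$ ($\ell=1,\dots,L$), subject to $$p_N=\frac1{2^{N-1}},\qquad \mathbf{Q}^{\pm,\ell}\succeq 0,\qquad \mathbf{R}^{\pm,\ell}\succeq0,$$ and, for each $\ell=1,\dots,L$ and each choice of sign $\pm$, $$\sum_{i-j=m}Q^{\pm,\ell}_{i,j}+\alpha_\ell\sum_{i-j=m-1}R^{\pm,\ell}_{i,j}-\beta_\ell\sum_{i-j=m}R^{\pm,\ell}_{i,j}+\overline{\alpha_\ell}\sum_{i-j=m+1}R^{\pm,\ell}_{i,j}=\begin{cases}\frac12\sigma_mc\pm\frac12(\mathbf{W}\mathbf{p})_m,& m=1,\dots,M,\\ \sigma_0c\pm(\mathbf{W}\mathbf{p})_0,& m=0.\end{cases}$$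
   Context: $T_n$ denotes the usual Chebyshev polynomial of the first kind, $T_n(\cos\theta)=\cos(n\theta)$. The $N$th Chebyshev polynomial of the first kind for $K$ with weight $w$ (a continuous positive function on $K$) is the (unique) monic real polynomial $\mathcal{T}_N^{K,w}$ of degree $N$ minimizing $\|P/w\|_K=\max_{x\in K}|P(x)/w(x)|$ over all monic polynomials $P$ of degree $N$. In the sums, $i,j$ are the row and column indices of the matrix concerned, and the sum runs over all admissible pairs of indices with the prescribed difference (an empty sum is $0$). $\succeq0$ means Hermitian positive semidefinite. *)

(* Defs.v *)
From HB Require Import structures.
From mathcomp Require Import all_boot all_order all_algebra.
From mathcomp Require Import complex.
From mathcomp Require Import all_classical all_reals all_analysis.
From mathcomp Require Import ring.

Set Implicit Arguments.
Unset Strict Implicit.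
Unset Printing Implicit Defensive.

Import Order.TTheory GRing.Theory Num.Theory.
Import numFieldNormedType.Exports.

Local Open Scope classical_set_scope.
Local Open Scope ring_scope.

Section Chebyshev.
Variable R : realType.
Local Notation C := R[i].

Fixpoint chebT (n : nat) : {poly R} :=
  match n with
  | 0 => 1
  | n'.+1 => match n' with
             | 0 => 'X
             | m.+1 => 2%:R *: ('X * chebT n') - chebT m
             end
  end.

Lemma chebT_cos n (t : R) : (chebT n).[cos t] = cos (n%:R * t).
Proof.
have [] : (chebT n).[cos t] = cos (n%:R * t) /\
          (chebT n.+1).[cos t] = cos (n.+1%:R * t); last by [].
elim: n => [|n [IH1 IH2]].
  by rewrite /= hornerC hornerX mul0r cos0 mul1r.
split=> //.
rewrite -[chebT n.+2]/(2%:R *: ('X * chebT n.+1) - chebT n).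
rewrite !(hornerD, hornerN, hornerZ, hornerM, hornerX) IH1 IH2.
have -> : n%:R * t = n.+1%:R * t - t by rewrite -natr1 mulrDl mul1r addrK.
have -> : n.+2%:R * t = n.+1%:R * t + t by rewrite -natr1 mulrDl mul1r.
by rewrite cosB cosD; ring.
Qed.

Definition cheb_sum n (p : 'cV[R]_n) : {poly R} :=
  \sum_(k < n) p k 0 *: chebT k.

Definition bands L (a b : 'I_L -> R) : set R :=
  \bigcup_(l in [set: 'I_L]) [set x | a l <= x <= b l].

(* For K compact nonempty and w continuous positive on K this supremum is the
   maximum of |P / w| over K. *)
Definition wnorm (K : set R) (w : R -> R) (P : {poly R}) : R :=
  sup [set `|P.[x] / w x| | x in K].

Definition is_chebyshev_poly (N : nat) (K : set R) (w : R -> R)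
    (P : {poly R}) : Prop :=
  [/\ P \is monic, size P = N.+1 &
      forall S : {poly R}, S \is monic -> size S = N.+1 ->
        wnorm K w P <= wnorm K w S].

(* exp(it) for real t *)
Definition expi (t : R) : C := Complex (cos t) (sin t).

Definition band_alpha (a b : R) : C :=
  (2^-1)%:C%C * expi (acos a / 2 + acos b / 2).

Definition band_beta (a b : R) : R := cos (acos a / 2 - acos b / 2).

Definition psdmx n (A : 'M[C]_n) : Prop :=
  A \is hermsymmx /\
  forall x : 'cV[C]_n, 0 <= ((map_mx Num.conj x)^T *m A *m x) 0 0.

Definition diag_sum n (A : 'M[C]_n) (k : int) : C :=
  \sum_(i < n) \sum_(j < n | i%:Z - j%:Z == k) A i j.

(* The Boolean index s encodes the superscript sign: false is +, true is -,
   so that (-1) ^+ s is the sign. *)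
Definition sdp_feasible (N M L : nat) (a b : 'I_L -> R)
    (sigma : 'cV[R]_M.+1) (W : 'M[R]_(M.+1, N.+1))
    (c : R) (p : 'cV[R]_N.+1)
    (Q : bool -> 'I_L -> 'M[C]_M.+1) (Y : bool -> 'I_L -> 'M[C]_M) : Prop :=
  [/\ p ord_max 0 = (2 ^+ N.-1)^-1,
      forall s l, psdmx (Q s l),
      forall s l, psdmx (Y s l) &
      forall (s : bool) (l : 'I_L) (m : 'I_M.+1),
        let alpha := band_alpha (a l) (b l) in
        let beta := band_beta (a l) (b l) in
        diag_sum (Q s l) m%:Z
        + alpha * diag_sum (Y s l) (m%:Z - 1)
        - beta%:C%C * diag_sum (Y s l) m%:Z
        + Num.conj alpha * diag_sum (Y s l) (m%:Z + 1)
        = (if m == 0%N :> nat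
           then sigma m 0 * c + (-1) ^+ s * (W *m p) m 0
           else 2^-1 * sigma m 0 * c
                + (-1) ^+ s * (2^-1 * (W *m p) m 0))%:C%C].

Definition sdp_minimizer (N M L : nat) (a b : 'I_L -> R)
    (sigma : 'cV[R]_M.+1) (W : 'M[R]_(M.+1, N.+1))
    (c : R) (p : 'cV[R]_N.+1)
    (Q : bool -> 'I_L -> 'M[C]_M.+1) (Y : bool -> 'I_L -> 'M[C]_M) : Prop :=
  sdp_feasible a b sigma W c p Q Y /\
  forall c' p' Q' Y', sdp_feasible a b sigma W c' p' Q' Y' -> c <= c'.

End Chebyshev.

(* Main.v *)
(** If [G] is a real polynomial with [G >= 0] on a band [[a, b]], then
   [G (cos t)] is a sum of squares plus [phi(t)] times a sum of squares, where
   [phi(t) = 2 Re (alpha e^(it)) - beta] is nonnegative exactly on the single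
   arc [-acos a <= t <= -acos b].  Such representations multiply without loss of
   degree because [phi^2] is itself the square of a trigonometric polynomial, so
   by factoring [G] over the reals only [x - a], [b - x] and squares have to be
   represented, and this is explicit.  Applied to [c Sigma +- Omega T], with [c]
   the weighted norm of [T], and written with Gram matrices, this is feasibility
   of the program; conversely, evaluating the constraints on the arc shows that a
   feasible value [c] bounds the weighted norm of the corresponding polynomial. *)
Require Import Defs.
From HB Require Import structures.
From mathcomp Require Import all_boot all_order all_algebra.
From mathcomp Require Import complex polyrcf.
From mathcomp Require Import all_classical all_reals all_analysis.
From mathcomp Require Import ring lra zify.

Set Implicit Arguments.
Unset Strict Implicit.
Unset Printing Implicit Defensive.

Import Order.TTheory GRing.Theory Num.Theory.
Import numFieldNormedType.Exports.

Local Open Scope classical_set_scope.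
Local Open Scope ring_scope.

(** * Weighted sums of squares on the unit circle *)

Section SumsOfSquares.
Variable R : realType.
Local Notation C := R[i].
Implicit Types (f g phi : C -> C) (z : C).

Definition unitc z := z * Num.conj z = 1.

Definition sqn (h : {poly C}) z := h.[z] * Num.conj h.[z].

(** [n] bounds sizes rather than degrees, so that it becomes the order of a Gram matrix of [f]. *)
Definition sos n f := exists2 hs : seq {poly C},
  all (fun h : {poly C} => size h <= n)%N hs &
  forall z, unitc z -> f z = \sum_(h <- hs) sqn h z.

Lemma eq_sos n f g : (forall z, unitc z -> f z = g z) -> sos n f -> sos n g.
Proof. by move=> fg [hs shs e]; exists hs => // z uz; rewrite -fg ?e. Qed.

Lemma sos_sqn n (h : {poly C}) : (size h <= n)%N -> sos n (sqn h).
Proof. by exists [:: h] => [|z _]; rewrite ?big_seq1 //= andbT. Qed.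

Lemma sos0 n : sos n (fun=> 0).
Proof. by exists [::] => // z _; rewrite big_nil. Qed.

Lemma sos_leq m n f : (m <= n)%N -> sos m f -> sos n f.
Proof.
move=> mn [hs shs e]; exists hs => //.
by apply: sub_all shs => h /leq_trans; apply.
Qed.

Lemma sosD n f g : sos n f -> sos n g -> sos n (fun z => f z + g z).
Proof.
move=> [hs shs ef] [ks sks eg]; exists (hs ++ ks); first by rewrite all_cat shs.
by move=> z uz; rewrite big_cat ef // eg.
Qed.

(** [|h|^2 |k|^2 = |h k|^2], and a nonzero product has size one less than the sum of the sizes,
    whence [p.+1]. *)
Lemma sosM m n p f g : (m + n <= p.+1)%N -> sos m f -> sos n g ->
  sos p (fun z => f z * g z).
Proof.
move=> mnp [hs shs ef] [ks sks eg]; exists [seq h * k | h <- hs, k <- ks].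
  apply/allP=> q /allpairsP[[h k] /= [hin kin ->]].
  have := size_polyMleq h k; have := allP shs _ hin; have := allP sks _ kin => /=.
  lia.
move=> z uz; rewrite ef // eg // big_allpairs_dep mulr_suml.
apply: eq_bigr => h _; rewrite mulr_sumr; apply: eq_bigr => k _.
by rewrite /sqn hornerM rmorphM /= mulrACA.
Qed.

Lemma sosZ n (r : R) f : 0 <= r -> sos n f -> sos n (fun z => r%:C%C * f z).
Proof.
move=> r0 sf; apply: (@sosM 1 n) => //.
exists [:: ((Num.sqrt r)%:C%C)%:P]; first by rewrite /= size_polyC_leq1.
move=> z _; rewrite big_seq1 /sqn hornerC [Num.conj _]conjc_real -rmorphM /=.
by rewrite -expr2 sqr_sqrtr.
Qed.

(** For [m = M] the bounds [m.+1] and [m] are the orders of the matrices [Q] and [Y] of the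
    program. *)
Definition wsos phi m f := exists f0 f1,
  [/\ sos m.+1 f0, sos m f1 & forall z, unitc z -> f z = f0 z + phi z * f1 z].

Lemma eq_wsos phi m f g :
  (forall z, unitc z -> f z = g z) -> wsos phi m f -> wsos phi m g.
Proof.
by move=> fg [f0 [f1 [s0 s1 e]]]; exists f0, f1; split => // z uz; rewrite -fg ?e.
Qed.

Lemma sos_wsos phi m f : sos m.+1 f -> wsos phi m f.
Proof.
by move=> sf; exists f, (fun=> 0); split=> [||z _] //; [exact: sos0|rewrite mulr0 addr0].
Qed.

Lemma wsos_leq phi m n f : (m <= n)%N -> wsos phi m f -> wsos phi n f.
Proof.
move=> mn [f0 [f1 [s0 s1 e]]].
by exists f0, f1; split=> //; [exact: sos_leq s0|exact: sos_leq s1].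
Qed.

(* One degree is positive so that the size bound [3 + (m + n)] for [q * f1 * g1]
   involves no truncated subtraction. *)
Lemma wsosM phi (q : {poly C}) m n f g :
  (size q <= 3)%N -> (forall z, unitc z -> phi z * phi z = sqn q z) ->
  wsos phi m.+1 f -> wsos phi n g -> wsos phi (m.+1 + n) (fun z => f z * g z).
Proof.
move=> sq eq [f0 [f1 [sf0 sf1 ef]]] [g0 [g1 [sg0 sg1 eg]]].
(* Since [phi^2 = |q|^2], the term [phi^2 f1 g1] of the product joins the unweighted part. *)
exists (fun z => f0 z * g0 z + sqn q z * (f1 z * g1 z)),
  (fun z => f0 z * g1 z + f1 z * g0 z); split.
- apply: sosD; first by apply: (sosM _ sf0 sg0); lia.
  apply: (@sosM 3 (m + n)); [lia|exact: sos_sqn|].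
  by apply: (sosM _ sf1 sg1); lia.
- by apply: sosD; [apply: (sosM _ sf0 sg1)|apply: (sosM _ sf1 sg0)]; lia.
by move=> z uz; rewrite ef // eg // -eq //; ring.
Qed.

End SumsOfSquares.

(** * The trigonometric weight of an arc *)

Section ArcFactor.
Variable R : realType.
Local Notation C := R[i].

Definition arc_fun (alpha : C) (beta : R) (z : C) : C :=
  alpha * z + Num.conj alpha * Num.conj z - beta%:C%C.

(** On the unit circle this is [z] times [arc_fun], the factor [z] clearing [conj z]. *)
Definition arc_poly (alpha : C) (beta : R) : {poly C} :=
  alpha *: 'X^2 - beta%:C%C *: 'X + (Num.conj alpha)%:P.

Lemma size_arc_poly alpha beta : (size (arc_poly alpha beta) <= 3)%N.
Proof.
rewrite /arc_poly (leq_trans (size_polyD _ _)) // geq_max.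
rewrite (leq_trans (size_polyD _ _)) ?geq_max ?size_polyN.
  by rewrite (leq_trans (size_polyC_leq1 _)).
by rewrite !(leq_trans (size_scale_leq _ _)) ?size_polyXn ?size_polyX.
Qed.

Lemma horner_arc_poly alpha beta z :
  unitc z -> (arc_poly alpha beta).[z] = z * arc_fun alpha beta z.
Proof.
rewrite /unitc /arc_fun => uz.
rewrite !(hornerD, hornerN, hornerZ, hornerXn, hornerX, hornerC).
by rewrite !mulrDr [z * (Num.conj alpha * _)]mulrCA uz; ring.
Qed.

Lemma arc_funE (u v x y beta : R) :
  arc_fun (Complex (u / 2) (v / 2)) beta (Complex x y) = (u * x - v * y - beta)%:C%C.
Proof.
by rewrite /arc_fun /Num.conj /=; simpc; congr Complex; field.
Qed.

(** [arc_fun] is real, so its square is its squared modulus, which a factor [z] of modulus one does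
    not change. *)
Lemma arc_fun_sqr alpha beta z : unitc z ->
  arc_fun alpha beta z * arc_fun alpha beta z = sqn (arc_poly alpha beta) z.
Proof.
move=> uz; rewrite /sqn horner_arc_poly // rmorphM /= mulrACA uz mul1r.
congr (_ * _); case: alpha => u v; case: z uz => x y _.
have -> : Complex u v = Complex (u * 2 / 2) (v * 2 / 2).
  by rewrite !mulfK ?pnatr_eq0.
by rewrite arc_funE [RHS]conjc_real.
Qed.

End ArcFactor.

(** * Polynomials nonnegative on an interval *)

Section Positivstellensatz.
Variable R : realType.
Local Notation C := R[i].

(** At [z = e^(it)] this is [G (cos t)]. *)
Definition reval (G : {poly R}) (z : C) : C := (G.[complex.Re z])%:C%C.

(** A negative value at [t] would persist in a neighbourhood of [t]. *)
Lemma horner_closure_ge0 (P : {poly R}) t :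
  (forall e, 0 < e -> exists2 y, `|y - t| < e & 0 <= P.[y]) -> 0 <= P.[t].
Proof.
move=> near0; rewrite leNgt; apply/negP => Pt0.
have [|d d0 dP] := @poly_cont R t P (- P.[t]); first by rewrite oppr_gt0.
have [y yt Py] := near0 _ d0.
have := dP _ yt; rewrite ltNge => /negP; apply.
by rewrite (le_trans _ (ler_norm _)) // lerDr.
Qed.

Lemma horner_ge0_left (P : {poly R}) s t : s < t ->
  (forall x, s < x < t -> 0 <= P.[x]) -> 0 <= P.[t].
Proof.
move=> st P0; apply: horner_closure_ge0 => e e0.
pose d := Num.min e (t - s); have d0 : 0 < d by rewrite lt_min e0 subr_gt0.
have [de ds] : d <= e /\ d <= t - s by rewrite /d !ge_min !lexx orbT.
exists (t - d / 2); last by apply: P0; apply/andP; split; lra.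
by rewrite addrC addKr normrN ger0_norm; lra.
Qed.

Lemma horner_ge0_right (P : {poly R}) s t : t < s ->
  (forall x, t < x < s -> 0 <= P.[x]) -> 0 <= P.[t].
Proof.
move=> ts P0; apply: horner_closure_ge0 => e e0.
pose d := Num.min e (s - t); have d0 : 0 < d by rewrite lt_min e0 subr_gt0.
have [de ds] : d <= e /\ d <= s - t by rewrite /d !ge_min !lexx orbT.
exists (t + d / 2); last by apply: P0; apply/andP; split; lra.
by rewrite addrAC subrr add0r ger0_norm; lra.
Qed.

(** [G] has a complex root [u + iv]. If [v != 0], the remainder modulo [(x - u)^2 + v^2] is a real
    [r0 + r1 x] vanishing there; the imaginary part gives [r1 = 0], then the real part [r0 = 0]. *)
Lemma real_poly_root_or_quadratic (G : {poly R}) : (1 < size G)%N ->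
  (exists t, root G t) \/
  (exists u v, v != 0 /\ ('X - u%:P) ^+ 2 + (v ^+ 2)%:P %| G).
Proof.
move=> sG.
have /closed_rootP[[u v]] : size (map_poly (real_complex R) G) != 1%N.
  by rewrite size_map_poly; case: (size G) sG => [|[]].
have [->|v0] := eqVneq v 0.
  by rewrite (fmorph_root (real_complex R)) => rG; left; exists u.
move=> rG; right; exists u, v; split=> //; set D := _ + _.
have sD : size D = 3%N.
  rewrite size_polyDl size_exp_XsubC //.
  by rewrite (leq_ltn_trans (size_polyC_leq1 _)).
have := ltn_modp G D; rewrite -size_poly_gt0 sD /= => sr.
rewrite /dvdp; set r := G %% D in sr *.
have : root (map_poly (real_complex R) r) (Complex u v).
  move: rG; rewrite {1}(divp_eq G D) -/r rmorphD rmorphM /= /root hornerD hornerM.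
  suff -> : (map_poly (real_complex R) D).[Complex u v] = 0 by rewrite mulr0 add0r.
  rewrite /D rmorphD rmorphXn rmorphB /= map_polyX !map_polyC /=.
  rewrite !hornerE /= expr2; simpc; congr Complex; ring.
rewrite /root (horner_coef_wide (n := 2)); last by rewrite size_map_poly.
rewrite !big_ord_recl big_ord0 /= !coef_map /= expr0 expr1; simpc => /eqP[].
move=> e0 /eqP; rewrite mulf_eq0 (negPf v0) orbF => /eqP r1.
rewrite -size_poly_leq0 leqNgt; apply/negP => r0.
have r0' : lead_coef r != 0 by rewrite lead_coef_eq0 -size_poly_gt0.
move: e0; rewrite r1 mul0r addr0 => e0.
move: r0'; rewrite lead_coefE; move: sr r0.
by case: (size r) => [|[|[]]] //= _ _; rewrite ?e0 ?r1 eqxx.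
Qed.

Variables (A B : R).
Let D := A / 2 - B / 2.
Let c := A / 2 + B / 2.
Hypothesis sA : 0 <= sin A.
Hypothesis sB : 0 <= sin B.
Hypothesis sc : 0 <= sin c.
Hypothesis sD : 0 < sin D.
Hypothesis cosAB : cos A < cos B.

(** At [z = e^(it)] this is [cos (t + c) - cos D]. With [A], [B] the arccosines of the band
    endpoints, the arc has centre [-c] and half-width [D]. *)
Let phi := arc_fun ((2^-1)%:C%C * expi c) (cos D).

Let phiE x y : phi (Complex x y) = (cos c * x - sin c * y - cos D)%:C%C.
Proof.
rewrite -arc_funE /phi /expi; congr (arc_fun _ _ _); simpc.
by congr Complex; rewrite mulrC.
Qed.

Let AE : A = c + D. Proof. by rewrite /c /D; field. Qed.
Let BE : B = c - D. Proof. by rewrite /c /D; field. Qed.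

(** This is [|e^(it) - e^(-is)|^2 = 2 (1 - cos (t + s))]. *)
Lemma sqn_XsubC_conj (u v x y : R) : x * x + y * y = 1 -> u ^+ 2 + v ^+ 2 = 1 ->
  sqn ('X - (Complex u (- v))%:P) (Complex x y) = (2 * (1 - (x * u - y * v)))%:C%C.
Proof.
move=> xy uv; rewrite /sqn hornerXsubC /Num.conj /=; simpc; congr Complex.
  rewrite (_ : 2 * _ = x * x + y * y + (u ^+ 2 + v ^+ 2) - 2 * (x * u - y * v)).
    by ring.
  by rewrite xy uv; ring.
by ring.
Qed.

Let unitcE (x y : R) : unitc (Complex x y) -> x * x + y * y = 1.
Proof.
by rewrite /unitc /Num.conj /=; simpc => -[+ _].
Qed.

(* [x - cos A - s phi] must have a double root at the endpoint [-A] of the arc,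
   so [s] is determined by the derivatives there and the remainder is a multiple
   of [1 - cos (t + A) = |z - e^(-iA)|^2 / 2]. *)
Lemma wsos_ge_lower (t : R) : t <= cos A -> wsos phi 1 (reval ('X - t%:P)).
Proof.
move=> tA.
exists (fun z : C => (sin c / (2 * sin D))%:C%C *
       sqn ('X - (Complex (cos A) (- sin A))%:P) z + (cos A - t)%:C%C * sqn 1 z),
  (fun z : C => (sin A / sin D)%:C%C * sqn 1 z); split.
- apply: sosD; apply: sosZ.
  + by rewrite divr_ge0 // mulr_ge0 // ltW.
  + by apply: sos_sqn; rewrite size_XsubC.
  + by rewrite subr_ge0.
  + by apply: sos_sqn; rewrite size_poly1.
- by apply: sosZ; [rewrite divr_ge0 // ltW|apply: sos_sqn; rewrite size_poly1].
case=> x y /unitcE xy; rewrite sqn_XsubC_conj ?cos2Dsin2 // phiE /reval /sqn.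
rewrite hornerXsubC hornerC rmorph1 !mulr1 -!rmorphM -!rmorphD /=; congr (_%:C)%C.
have D0 : sin D != 0 by rewrite gt_eqF.
rewrite AE (cosD c) (sinD c); apply/eqP; rewrite -subr_eq0; apply/eqP.
(* After [A = c + D] is expanded, the difference of the two sides is a combination of two
   Pythagorean identities. *)
transitivity (- x * (cos c ^+ 2 + sin c ^+ 2 - 1)
  + sin c / sin D * (cos D ^+ 2 + sin D ^+ 2 - 1)); first by field.
by rewrite !cos2Dsin2; ring.
Qed.

(** Mirror image of [wsos_ge_lower], with the double root at the other endpoint [-B] of the arc. *)
Lemma wsos_le_upper (t : R) : cos B <= t -> wsos phi 1 (reval (t%:P - 'X)).
Proof.
move=> Bt.
exists (fun z : C => (sin c / (2 * sin D))%:C%C *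
       sqn ('X - (Complex (cos B) (- sin B))%:P) z + (t - cos B)%:C%C * sqn 1 z),
  (fun z : C => (sin B / sin D)%:C%C * sqn 1 z); split.
- apply: sosD; apply: sosZ.
  + by rewrite divr_ge0 // mulr_ge0 // ltW.
  + by apply: sos_sqn; rewrite size_XsubC.
  + by rewrite subr_ge0.
  + by apply: sos_sqn; rewrite size_poly1.
- by apply: sosZ; [rewrite divr_ge0 // ltW|apply: sos_sqn; rewrite size_poly1].
case=> x y /unitcE xy; rewrite sqn_XsubC_conj ?cos2Dsin2 // phiE /reval /sqn.
rewrite hornerD hornerN hornerX !hornerC rmorph1 !mulr1 -!rmorphM -!rmorphD /=.
congr (_%:C)%C.
have D0 : sin D != 0 by rewrite gt_eqF.
rewrite BE (cosB c) (sinB c); apply/eqP; rewrite -subr_eq0; apply/eqP.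
transitivity (x * (cos c ^+ 2 + sin c ^+ 2 - 1)
  + sin c / sin D * (cos D ^+ 2 + sin D ^+ 2 - 1)); first by field.
by rewrite !cos2Dsin2; ring.
Qed.

(** [cos t - u] is itself an [arc_fun], with [alpha = 1/2] and [beta = u], so its square is a single
    squared modulus. *)
Lemma sos_XsubC_sqr (u : R) : sos 3 (reval (('X - u%:P) ^+ 2)).
Proof.
apply: (@eq_sos _ _ (sqn (arc_poly (Complex (1 / 2) (0 / 2)) u))).
  case=> x y uz; rewrite -arc_fun_sqr // arc_funE /reval /= !hornerE -rmorphM.
  by congr (_%:C)%C; ring.
exact/sos_sqn/size_arc_poly.
Qed.

Lemma wsos_quadratic (u v : R) : wsos phi 2 (reval (('X - u%:P) ^+ 2 + (v ^+ 2)%:P)).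
Proof.
apply: sos_wsos.
apply: (@eq_sos _ _ (fun z => reval (('X - u%:P) ^+ 2) z + (v ^+ 2)%:C%C * sqn 1 z)).
  by move=> z _; rewrite /sqn hornerC rmorph1 !mulr1 -rmorphD /reval hornerD !hornerC.
apply: sosD; first exact: sos_XsubC_sqr.
by apply: sosZ; [exact: sqr_ge0|apply: sos_sqn; rewrite size_poly1].
Qed.

Lemma wsos_reval_mul (F G : {poly R}) : (1 < size F)%N -> G != 0 ->
  wsos phi (size F).-1 (reval F) -> wsos phi (size G).-1 (reval G) ->
  wsos phi (size (F * G)).-1 (reval (F * G)).
Proof.
move=> sF G0 wF wG.
have F0 : F != 0 by rewrite -size_poly_gt0 ltnW.
rewrite size_mul //; move: wF; rewrite (polySpred F0).
case: (size F) sF => [|[|n]] //= _ wF.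
apply: (@eq_wsos _ _ _ (fun z => reval F z * reval G z)).
  by move=> z _; rewrite /reval hornerM rmorphM.
rewrite (polySpred G0) addnS /=.
exact: wsosM (size_arc_poly _ _) (@arc_fun_sqr _ _ _) wF wG.
Qed.

(** Induction on the size, splitting off a factor that is positive on the open interval, or the
    square of a factor vanishing inside it. Positivity is asked on the open interval only, so that
    it passes to the cofactor of a root at an endpoint. *)
Lemma wsos_ge0 (G : {poly R}) : (forall x, cos A < x < cos B -> 0 <= G.[x]) ->
  wsos phi (size G).-1 (reval G).
Proof.
have [n] := ubnP (size G); elim: n G => // n IH G; rewrite ltnS => sGn G0.
have [sG|sG] := leqP (size G) 1.
  have := size1_polyC sG; set r := G`_0 => eG; rewrite eG.
  apply: sos_wsos.
  apply: (@eq_sos _ _ (fun z : C => r%:C%C * sqn 1 z)).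
    by move=> z _; rewrite /sqn /reval !hornerC rmorph1 !mulr1.
  apply: sosZ; last by apply: sos_sqn; rewrite size_poly1.
  (* The sign of a constant is read off at the midpoint. *)
  have := G0 ((cos A + cos B) / 2); rewrite eG hornerC; apply.
  by move: cosAB => ?; apply/andP; split; lra.
have nzG : G != 0 by rewrite -size_poly_gt0 ltnW.
have sz (F H : {poly R}) : (1 < size F)%N -> F * H = G -> H != 0 /\ (size H < n)%N.
  move=> sF eG; move: nzG; rewrite -eG mulf_eq0 negb_or => /andP[nF nH].
  split=> //; move: sGn; rewrite -eG size_mul //.
  by move: sF; case: (size F) => [|[|k]] //= _; apply: leq_trans; rewrite ltnS leq_addl.
have step (F H : {poly R}) : (1 < size F)%N -> wsos phi (size F).-1 (reval F) ->
    (forall x, cos A < x < cos B -> 0 <= H.[x]) -> F * H = G ->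
    wsos phi (size G).-1 (reval G).
  move=> sF wF H0 eG; have [nH sH] := sz _ _ sF eG; rewrite -eG.
  by apply: wsos_reval_mul => //; exact: IH.
have [[t]|[u [v [v0 /dvdpP[H eG]]]]] := real_poly_root_or_quadratic sG; last first.
  have sz2 : size (('X - u%:P) ^+ 2 + (v ^+ 2)%:P) = 3%N.
    by rewrite size_polyDl size_exp_XsubC // (leq_ltn_trans (size_polyC_leq1 _)).
  apply: (step (('X - u%:P) ^+ 2 + (v ^+ 2)%:P) H); rewrite ?sz2 //.
  - exact: wsos_quadratic.
  - move=> x /G0; rewrite eG !hornerE pmulr_lge0 //.
    by rewrite ltr_wpDl ?sqr_ge0 // exprn_even_gt0.
  - by rewrite mulrC.
move=> /factor_theorem[H eG].
have [tA|At] := leP t (cos A).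
  apply: (step ('X - t%:P) H); rewrite ?size_XsubC //.
  - exact: wsos_ge_lower.
  - move=> x xAB; have := G0 _ xAB; rewrite eG !hornerE pmulr_lge0 // subr_gt0.
    by case/andP: xAB => /(le_lt_trans tA).
  - by rewrite mulrC.
have [Bt|tB] := leP (cos B) t.
  have sz1 : size (t%:P - 'X) = 2%N by rewrite -opprB size_polyN size_XsubC.
  apply: (step (t%:P - 'X) (- H)); rewrite ?sz1 //.
  - exact: wsos_le_upper.
  - move=> x xAB; have := G0 _ xAB.
    rewrite eG !hornerE -mulrNN pmulr_lge0 // oppr_gt0 subr_lt0.
    by case/andP: xAB => _ /lt_le_trans; apply.
  - by rewrite eG mulrN -mulNr opprB mulrC.
(* At an interior root, [H >= 0] to the right of [t] and [H <= 0] to the left, so [H] vanishes at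
   [t] and the root is at least double. *)
have Ht : root H t.
  rewrite /root eq_le -oppr_ge0 -hornerN.
  rewrite (@horner_ge0_left _ (cos A)) // ?(@horner_ge0_right _ (cos B)) //.
    move=> x /andP[tx xB]; have : 0 <= G.[x] by rewrite G0 // xB (lt_trans At).
    by rewrite eG !hornerE pmulr_lge0 // subr_gt0.
  move=> x /andP[Ax xt]; have : 0 <= G.[x] by rewrite G0 // Ax (lt_trans xt).
  by rewrite eG !hornerE -mulrNN pmulr_lge0 // oppr_gt0 subr_lt0.
move/factor_theorem: Ht => [K eH].
have eG2 : G = K * ('X - t%:P) ^+ 2 by rewrite eG eH mulrA.
apply: (step (('X - t%:P) ^+ 2) K); rewrite ?size_exp_XsubC //.
- exact/sos_wsos/sos_XsubC_sqr.
(* Dividing by the square leaves the sign of [K] open only at [t], where continuity from the right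
   settles it. *)
- have K0 x : cos A < x < cos B -> x != t -> 0 <= K.[x].
    move=> /G0 + xt; rewrite eG2 hornerM horner_exp hornerXsubC pmulr_lge0 //.
    by rewrite exprn_even_gt0 // subr_eq0.
  move=> x xAB; have [->|/(K0 _ xAB)//] := eqVneq x t.
  apply: (@horner_ge0_right _ (cos B)) => // y /andP[ty yB].
  by rewrite K0 ?gt_eqF // yB (lt_trans At).
- by rewrite eG2 mulrC.
Qed.

End Positivstellensatz.

(** * Gram matrices and Chebyshev expansions *)

Section TrigonometricGram.
Variable R : realType.
Local Notation C := R[i].

Lemma chebT_rec n : chebT R n.+2 = 2%:R *: ('X * chebT R n.+1) - chebT R n.
Proof. by []. Qed.

(** Both sides are [2 cos (n t)] at [z = e^(it)]; as [z * conj z = 1], they obey the same two-term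
    recurrence. *)
Lemma chebT_circle n (z : C) : unitc z ->
  2 * reval (chebT R n) z = z ^+ n + Num.conj z ^+ n.
Proof.
move=> uz; have e1 : 2 * (complex.Re z)%:C%C = z + Num.conj z.
  by rewrite [Num.conj z]/(conjc z) addcJ.
suff [] : 2 * reval (chebT R n) z = z ^+ n + Num.conj z ^+ n /\
  2 * reval (chebT R n.+1) z = z ^+ n.+1 + Num.conj z ^+ n.+1 by [].
elim: n => [|n [IH1 IH2]].
  by rewrite /reval /= hornerC hornerX rmorph1 mulr1 !expr0 !expr1.
split=> //.
have -> : reval (chebT R n.+2) z =
    2 * ((complex.Re z)%:C%C * reval (chebT R n.+1) z) - reval (chebT R n) z.
  rewrite /reval chebT_rec hornerD hornerN hornerZ hornerM hornerX.
  by rewrite rmorphB !rmorphM rmorph_nat.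
set x := (complex.Re z)%:C%C in e1 *; set r1 := reval _ _ in IH2 *.
set r0 := reval _ _ in IH1 *.
have -> : 2 * (2 * (x * r1) - r0) = (2 * x) * (2 * r1) - 2 * r0 by ring.
rewrite e1 IH1 IH2.
have -> : z ^+ n = z * Num.conj z * z ^+ n by rewrite uz mul1r.
have -> : Num.conj z ^+ n = z * Num.conj z * Num.conj z ^+ n by rewrite uz mul1r.
by rewrite !exprS; ring.
Qed.

Lemma size_chebT n : (size (chebT R n) <= n.+1)%N.
Proof.
suff [] : (size (chebT R n) <= n.+1)%N /\ (size (chebT R n.+1) <= n.+2)%N by [].
elim: n => [|n [IH1 IH2]]; first by rewrite /= size_polyC_leq1 size_polyX.
split=> //; rewrite chebT_rec (leq_trans (size_polyD _ _)) // geq_max.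
apply/andP; split; last by rewrite size_polyN (leq_trans IH1) // leqW.
rewrite (leq_trans (size_scale_leq _ _)) // (leq_trans (size_polyMleq _ _)) //.
by rewrite size_polyX.
Qed.

Lemma chebT_lead n : (chebT R n.+1)`_n.+1 = 2 ^+ n.
Proof.
elim: n => [|n IH]; first by rewrite /= coefX.
rewrite chebT_rec coefB coefZ coefXM /= IH exprS.
by rewrite nth_default ?subr0 // (leq_trans (size_chebT _)).
Qed.

Lemma size_cheb_sum n (p : 'cV[R]_n) : (size (cheb_sum p) <= n)%N.
Proof.
rewrite /cheb_sum (leq_trans (size_sum _ _ _)) //; apply/bigmax_leqP => k _.
by rewrite (leq_trans (size_scale_leq _ _)) // (leq_trans (size_chebT _)).
Qed.

Lemma coef_cheb_sum n (p : 'cV[R]_n.+2) :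
  (cheb_sum p)`_n.+1 = p ord_max 0 * 2 ^+ n.
Proof.
rewrite /cheb_sum coef_sum big_ord_recr /= coefZ chebT_lead big1 ?add0r // => i _.
by rewrite coefZ nth_default ?mulr0 // (leq_trans (size_chebT _)) /=.
Qed.

(** [chebT R n] has degree exactly [n], so a multiple of it removes the top coefficient. *)
Lemma cheb_sum_surj n (P : {poly R}) :
  (size P <= n)%N -> exists p : 'cV[R]_n, P = cheb_sum p.
Proof.
(* Coefficients indexed by all naturals keep their type during the induction on [n]. *)
suff H : (size P <= n)%N -> exists f : nat -> R, P = \sum_(k < n) f k *: chebT R k.
  by move=> /H[f ->]; exists (\col_k f k); apply: eq_bigr => k _; rewrite mxE.
elim: n P => [|n IH] P sP.
  by exists (fun=> 0); rewrite big_ord0; apply/eqP; rewrite -size_poly_leq0.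
pose t := P`_n / (chebT R n)`_n.
have t0 : (chebT R n)`_n != 0.
  by case: (n) => [|m]; rewrite ?chebT_lead ?expf_neq0 ?pnatr_eq0 //= coefC oner_eq0.
have [|f eP] := IH (P - t *: chebT R n).
  apply/leq_sizeP => k; rewrite leq_eqVlt coefB coefZ => /predU1P[<-|nk].
    by rewrite /t divfK ?subrr.
  rewrite (nth_default _ (leq_trans sP nk)).
  by rewrite (nth_default _ (leq_trans (size_chebT _) nk)) mulr0 subrr.
exists (fun k => if k == n then t else f k).
rewrite big_ord_recr /= eqxx; apply/eqP; rewrite -subr_eq eP; apply/eqP.
by apply: eq_bigr => k _; rewrite ltn_eqF.
Qed.

(** On the unit circle this is a Laurent polynomial whose coefficient of [z ^ m] is
    [diag_sum A m]. *)
Definition quad n (A : 'M[C]_n) (z : C) :=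
  \sum_(i < n) \sum_(j < n) A i j * (z ^+ i * Num.conj z ^+ j).

(* On the unit circle this is [z ^ (n - 1 + s) * quad A z]; the shift makes all
   exponents natural numbers. *)
Definition gram_poly n (A : 'M[C]_n) s : {poly C} :=
  \sum_(i < n) \sum_(j < n) A i j *: 'X^(i + rev_ord j + s).

Lemma coef_gram_poly n (A : 'M[C]_n) s (k : nat) :
  (gram_poly A s)`_k = diag_sum A (k%:Z + 1 - n%:Z - s%:Z).
Proof.
rewrite /gram_poly /diag_sum coef_sum; apply: eq_bigr => i _.
rewrite coef_sum [RHS]big_mkcond; apply: eq_bigr => j _.
rewrite coefZ coefXn (_ : (k == _) = (i%:Z - j%:Z == k%:Z + 1 - n%:Z - s%:Z)).
  by case: eqP; rewrite ?mulr1 ?mulr0.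
by have := ltn_ord j => /=; lia.
Qed.

(** The extra factor [z] turns the exponent [n - 1 + s] into [n + s], which is also right for
    [n = 0]. *)
Lemma horner_gram_poly n (A : 'M[C]_n) s z : unitc z ->
  z * (gram_poly A s).[z] = z ^+ (n + s) * quad A z.
Proof.
move=> uz; rewrite /gram_poly /quad horner_sum !mulr_sumr; apply: eq_bigr => i _.
rewrite horner_sum !mulr_sumr; apply: eq_bigr => j _.
rewrite hornerZ hornerXn.
have -> : (n + s = (i + rev_ord j + s).+1 - i + j)%N.
  by have := ltn_ord j => /=; lia.
have -> : z ^+ ((i + rev_ord j + s).+1 - i + j) * (A i j * (z ^+ i * Num.conj z ^+ j)) =
   A i j * (z ^+ ((i + rev_ord j + s).+1 - i + i) * (z * Num.conj z) ^+ j).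
  by rewrite exprMn !exprD; ring.
rewrite uz expr1n subnK ?exprS; last by lia.
by ring.
Qed.

Lemma diag_sum_out n (A : 'M[C]_n) (k : int) : n%:Z <= k -> diag_sum A k = 0.
Proof.
move=> nk; rewrite /diag_sum big1 // => i _; rewrite big_pred0 // => j.
by apply/eqP; have := ltn_ord i; lia.
Qed.

Lemma diag_sum_opp n (A : 'M[C]_n) (k : int) : A \is hermsymmx ->
  diag_sum A (- k) = Num.conj (diag_sum A k).
Proof.
move=> /is_hermitianmxP; rewrite expr0 scale1r => hA.
rewrite /diag_sum rmorph_sum (exchange_big_dep xpredT) //=; apply: eq_bigr => i _.
rewrite rmorph_sum; apply: eq_big => j; first by lia.
by move=> _; rewrite [in LHS]hA !mxE.
Qed.

Variables (M : nat) (alpha : C) (beta : R).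

Definition sdp_lhs (Q : 'M[C]_M.+1) (Y : 'M[C]_M) (m : int) : C :=
  diag_sum Q m + alpha * diag_sum Y (m - 1) - beta%:C%C * diag_sum Y m
  + Num.conj alpha * diag_sum Y (m + 1).

(** Everything is centred at degree [M]. As [Y] has order one less than [Q], it needs the shift 1,
    which the factors [z] and [conj z] of the weight change to 2 and 0. *)
Definition sdp_poly (Q : 'M[C]_M.+1) (Y : 'M[C]_M) : {poly C} :=
  gram_poly Q 0 + alpha *: gram_poly Y 2 - beta%:C%C *: gram_poly Y 1
  + Num.conj alpha *: gram_poly Y 0.

Lemma coef_sdp_poly Q Y (k : nat) : (sdp_poly Q Y)`_k = sdp_lhs Q Y (k%:Z - M%:Z).
Proof.
rewrite /sdp_poly coefD coefB coefD !coefZ !coef_gram_poly /sdp_lhs.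
have -> : k%:Z + 1 - M.+1%:Z - 0%:Z = k%:Z - M%:Z by lia.
have -> : k%:Z + 1 - M%:Z - 2%:Z = k%:Z - M%:Z - 1 by lia.
have -> : k%:Z + 1 - M%:Z - 1%:Z = k%:Z - M%:Z by lia.
by have -> : k%:Z + 1 - M%:Z - 0%:Z = k%:Z - M%:Z + 1 by lia.
Qed.

Lemma horner_sdp_poly Q Y z : unitc z ->
  z * (sdp_poly Q Y).[z] = z ^+ M.+1 * (quad Q z + arc_fun alpha beta z * quad Y z).
Proof.
move=> uz; rewrite /sdp_poly hornerD hornerD hornerN hornerD !hornerZ.
rewrite mulrDr mulrDr mulrDr mulrN !(mulrCA z) !horner_gram_poly // /arc_fun.
rewrite addn2 addn1 addn0 addn0.
have -> : z ^+ M = z * Num.conj z * z ^+ M by rewrite uz mul1r.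
by rewrite !exprS; ring.
Qed.

(** The program constrains only [m >= 0]; this recovers the negative indices. *)
Lemma sdp_lhs_opp Q Y (m : int) : Q \is hermsymmx -> Y \is hermsymmx ->
  sdp_lhs Q Y (- m) = Num.conj (sdp_lhs Q Y m).
Proof.
move=> hQ hY; rewrite /sdp_lhs !(rmorphD, rmorphN, rmorphM) /= -!diag_sum_opp //.
rewrite conjCK [Num.conj beta%:C%C]conjc_real.
rewrite (_ : - (m - 1) = - m + 1); last by lia.
rewrite (_ : - (m + 1) = - m - 1); last by lia.
by ring.
Qed.

(** On the unit circle this is [z ^ M] times the Chebyshev sum at [Re z]. For [m = 0] the two
    monomials coincide, hence the separate case in the constraints. *)
Definition trig_poly (g : 'cV[R]_M.+1) : {poly C} :=
  \sum_(m < M.+1) (g m 0 / 2)%:C%C *: ('X^(M + m) + 'X^(M - m)).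

Lemma horner_trig_poly g z : unitc z ->
  z * (trig_poly g).[z] = z ^+ M.+1 * reval (cheb_sum g) z.
Proof.
move=> uz; rewrite /reval /cheb_sum /trig_poly !horner_sum (rmorph_sum (real_complex R)) /=.
rewrite !mulr_sumr; apply: eq_bigr => m _.
rewrite hornerZ hornerD !hornerXn hornerZ.
have mM : (m <= M)%N by rewrite -ltnS.
have -> : z ^+ (M - m) = z ^+ M * Num.conj z ^+ m.
  rewrite (_ : z ^+ M = z ^+ (M - m) * z ^+ m); last by rewrite -exprD subnK.
  by rewrite -mulrA -exprMn uz expr1n mulr1.
have -> : real_complex R (g m 0 * (chebT R m).[complex.Re z]) =
    (g m 0 / 2)%:C%C * (2 * reval (chebT R m) z).
  rewrite /reval -(rmorph_nat (real_complex R)) -!rmorphM; congr (_%:C)%C.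
  by rewrite mulrA divfK ?pnatr_eq0.
by rewrite chebT_circle // exprD exprS; ring.
Qed.

Lemma coef_trig_poly g k : (trig_poly g)`_k =
  \sum_(m < M.+1) (g m 0 / 2)%:C%C * ((k == M + m)%N%:R + (k == M - m)%N%:R).
Proof.
rewrite /trig_poly coef_sum; apply: eq_bigr => m _.
by rewrite coefZ coefD !coefXn.
Qed.

Lemma coef_trig_polyD g (m : 'I_M.+1) : (trig_poly g)`_(M + m) =
  (if m == 0%N :> nat then g m 0 else g m 0 / 2)%:C%C.
Proof.
rewrite coef_trig_poly (bigD1 m) //= big1 ?addr0 => [|k km].
  rewrite eqxx; have -> : (M + m == M - m)%N = (m == 0%N :> nat) by lia.
  case: eqP => _; last by rewrite addr0 mulr1.
  by rewrite -mulr2n -(rmorph_nat (real_complex R)) -rmorphM divfK ?pnatr_eq0.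
have : (k == m :> nat) = false by apply: contraNF km => /eqP e; apply/eqP/val_inj.
move=> km'; have -> : (M + m == M + k)%N = false by lia.
have -> : (M + m == M - k)%N = false by have := ltn_ord k; lia.
by rewrite addr0 mulr0.
Qed.

Lemma coef_trig_polyB g k : (k <= M)%N ->
  (trig_poly g)`_(M - k) = (trig_poly g)`_(M + k).
Proof.
move=> kM; rewrite !coef_trig_poly; apply: eq_bigr => m _; rewrite addrC.
have mM : (m <= M)%N by rewrite -ltnS.
by congr (_ * (_%:R + _%:R)); congr nat_of_bool; lia.
Qed.

Lemma coef_trig_poly_out g k : (M < k)%N -> (trig_poly g)`_(M + k) = 0.
Proof.
move=> Mk; rewrite coef_trig_poly big1 // => m _; have := ltn_ord m => mM.
have -> : (M + k == M + m)%N = false by lia.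
have -> : (M + k == M - m)%N = false by lia.
by rewrite addr0 mulr0.
Qed.

(** The points of the upper half circle with abscissas [1 / (k + 1)] are distinct roots of [P - P'],
    as many as its size. *)
Lemma poly_eq_circle (P P' : {poly C}) :
  (forall z, unitc z -> P.[z] = P'.[z]) -> P = P'.
Proof.
move=> PP; apply/eqP; rewrite -subr_eq0; apply/eqP.
pose x k : R := k.+1%:R^-1; pose pt k := Complex (x k) (Num.sqrt (1 - x k ^+ 2)).
apply: (@roots_geq_poly_eq0 _ _ (mkseq pt (size (P - P')))).
- apply/allP => _ /mapP[k _ ->]; rewrite /root hornerD hornerN PP ?subrr //.
  have xk : x k ^+ 2 <= 1 by rewrite exprn_ile1 ?invr_ge0 // invf_le1 ?ler1n.
  rewrite /unitc /Num.conj /=; simpc; congr Complex; last by ring.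
  by rewrite -!expr2 sqr_sqrtr ?subr_ge0 // addrC subrK.
- apply/mkseq_uniqP => i j _ _ [/invr_inj/eqP]; rewrite eqr_nat => /eqP[->] //.
- by rewrite size_mkseq.
Qed.

Lemma sdp_lhs_circle Q Y g :
  (forall z, unitc z ->
     reval (cheb_sum g) z = quad Q z + arc_fun alpha beta z * quad Y z) ->
  forall k : nat, sdp_lhs Q Y k = (trig_poly g)`_(M + k).
Proof.
move=> gQY k; suff -> : trig_poly g = sdp_poly Q Y.
  by rewrite coef_sdp_poly; congr sdp_lhs; lia.
(* The evaluation lemmas carry an extra factor [z], matched here by ['X]. *)
suff : 'X * trig_poly g = 'X * sdp_poly Q Y by apply: mulfI; rewrite polyX_eq0.
apply: poly_eq_circle => z uz; rewrite !hornerM !hornerX horner_trig_poly //.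
by rewrite gQY // horner_sdp_poly.
Qed.

Lemma circle_sdp_lhs Q Y g : Q \is hermsymmx -> Y \is hermsymmx ->
  (forall m : 'I_M.+1, sdp_lhs Q Y m = (trig_poly g)`_(M + m)) ->
  forall z, unitc z ->
     reval (cheb_sum g) z = quad Q z + arc_fun alpha beta z * quad Y z.
Proof.
move=> hQ hY e z uz.
have z0 : z ^+ M.+1 != 0.
  by rewrite expf_neq0 //; apply: contra_eq_neq uz => ->; rewrite mul0r eq_sym oner_eq0.
apply: (mulfI z0); rewrite -horner_trig_poly // -horner_sdp_poly //.
congr (_ * _.[_]); apply/polyP => k; rewrite coef_sdp_poly.
(* Degrees [k <= M] belong to indices [-j <= 0], reached by conjugation because the coefficients of
   [trig_poly g] are real and symmetric. Beyond degree [2 M] both sides vanish. *)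
have [kM|Mk] := leqP k M.
  have := subnKC kM; have := leq_subr k M; set j := (M - k)%N => jM ejk.
  rewrite (_ : k%:Z - M%:Z = - j%:Z); last by lia.
  have -> : k = (M - j)%N by lia.
  rewrite coef_trig_polyB // sdp_lhs_opp //.
  have := e (Ordinal (jM : (j < M.+1)%N)); rewrite coef_trig_polyD /= => ->.
  rewrite -(coef_trig_polyD g (Ordinal (jM : (j < M.+1)%N))) coef_trig_polyD.
  by rewrite [RHS]conjc_real.
have := subnKC (ltnW Mk); set j := (k - M)%N => <-.
rewrite (_ : (M + j)%N%:Z - M%:Z = j%:Z); last by lia.
have [jM|Mj] := leqP j M; first by rewrite -(e (Ordinal (jM : (j < M.+1)%N))).
rewrite coef_trig_poly_out // /sdp_lhs !diag_sum_out ?mulr0; try by lia.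
by rewrite !addr0 subr0.
Qed.

End TrigonometricGram.

(** * Positive semidefinite matrices and sums of squares *)

Section GramMatrices.
Variable R : realType.
Local Notation C := R[i].

Lemma herm_formE n (A : 'M[C]_n) (x : 'cV[C]_n) :
  ((map_mx Num.conj x)^T *m A *m x) 0 0 =
  \sum_i \sum_j A i j * (Num.conj (x i 0) * x j 0).
Proof.
rewrite mxE exchange_big; apply: eq_bigr => j _; rewrite mxE mulr_suml.
by apply: eq_bigr => i _; rewrite !mxE mulrCA mulrA.
Qed.

(** [quad A z] is the Hermitian form of [A] at the vector of powers of [conj z]. *)
Lemma psdmx_quad_ge0 n (A : 'M[C]_n) z : psdmx A -> 0 <= quad A z.
Proof.
move=> [_ /(_ (\col_j Num.conj z ^+ j))]; rewrite herm_formE.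
by congr (_ <= _); apply: eq_bigr => i _; apply: eq_bigr => j _;
  rewrite !mxE rmorphXn /= conjCK.
Qed.

(** Each square contributes the rank-one matrix of its coefficient vector, whose Hermitian form is a
    squared modulus. *)
Lemma sos_psdmx n (f : C -> C) : sos n f ->
  exists2 A : 'M[C]_n, psdmx A & forall z, unitc z -> f z = quad A z.
Proof.
move=> [hs shs fE]; exists (\matrix_(i, j) \sum_(h <- hs) h`_i * Num.conj h`_j).
  split=> [|x].
    apply/is_hermitianmxP; rewrite expr0 scale1r; apply/matrixP => i j.
    rewrite !mxE rmorph_sum; apply: eq_bigr => h _.
    by rewrite rmorphM /= conjCK mulrC.
  rewrite herm_formE.
  suff -> : \sum_i \sum_j (\matrix_(i, j) \sum_(h <- hs) h`_i * Num.conj h`_j)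
        i j * (Num.conj (x i 0) * x j 0) =
      \sum_(h <- hs) (\sum_(i < n) h`_i * Num.conj (x i 0)) *
        Num.conj (\sum_(i < n) h`_i * Num.conj (x i 0)).
    by apply: sumr_ge0 => h _; exact: mul_conjC_ge0.
  under [RHS]eq_bigr do rewrite mulr_suml; rewrite [RHS]exchange_big.
  apply: eq_bigr => i _; under [RHS]eq_bigr do rewrite rmorph_sum mulr_sumr.
  rewrite [RHS]exchange_big; apply: eq_bigr => j _; rewrite mxE mulr_suml.
  by apply: eq_bigr => h _; rewrite rmorphM /= conjCK; ring.
move=> z /fE->; rewrite /quad.
transitivity (\sum_(h <- hs) \sum_(i < n) \sum_(j < n)
    h`_i * Num.conj h`_j * (z ^+ i * Num.conj z ^+ j)).
  rewrite big_seq [RHS]big_seq; apply: eq_bigr => h /(allP shs) /= sh.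
  rewrite /sqn (horner_coef_wide _ sh) mulr_suml; apply: eq_bigr => i _.
  rewrite rmorph_sum mulr_sumr; apply: eq_bigr => j _.
  by rewrite rmorphM rmorphXn /=; ring.
rewrite exchange_big; apply: eq_bigr => i _; rewrite exchange_big.
by apply: eq_bigr => j _; rewrite mxE mulr_suml.
Qed.

End GramMatrices.

(** * Bands and their arcs *)

Section Bands.
Variable R : realType.

Lemma ltr_acos (x y : R) : -1 <= x -> x < y -> y <= 1 -> acos y < acos x.
Proof.
move=> x1 xy y1; have xB : -1 <= x <= 1 by rewrite x1 (le_trans (ltW xy)).
have yB : -1 <= y <= 1 by rewrite y1 (le_trans x1 (ltW xy)).
by rewrite -ltr_cos ?acosK ?in_itv //= ?acos_ge0 ?acos_lepi.
Qed.

Lemma ler_acos (x y : R) : -1 <= x -> x <= y -> y <= 1 -> acos y <= acos x.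
Proof.
by move=> x1; rewrite le_eqVlt => /predU1P[-> //|xy] y1; rewrite ltW ?ltr_acos.
Qed.

Variables a b : R.
Hypotheses (a1 : -1 <= a) (b1 : b <= 1) (ab : a < b).

Let aB : -1 <= a <= 1. Proof. by rewrite a1 (le_trans (ltW ab)). Qed.
Let bB : -1 <= b <= 1. Proof. by rewrite b1 (le_trans a1 (ltW ab)). Qed.

Lemma wsos_band (G : {poly R}) m : (size G <= m.+1)%N ->
  (forall x, a <= x <= b -> 0 <= G.[x]) ->
  wsos (arc_fun (band_alpha a b) (band_beta a b)) m (reval G).
Proof.
move=> sG G0; apply: (@wsos_leq _ _ (size G).-1).
  by case: (size G) sG.
have ca : cos (acos a) = a by rewrite acosK // in_itv.
have cb : cos (acos b) = b by rewrite acosK // in_itv.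
have [a0 api] := conj (acos_ge0 aB) (acos_lepi aB).
have [b0 bpi] := conj (acos_ge0 bB) (acos_lepi bB).
have ba := ltr_acos a1 ab b1.
apply: wsos_ge0; rewrite ?ca ?cb //.
- by rewrite sin_ge0_pi // a0.
- by rewrite sin_ge0_pi // b0.
- by rewrite sin_ge0_pi //; apply/andP; split; lra.
- by rewrite sin_gt0_pi //; apply/andP; split; lra.
- by move=> x /andP[ax xb]; rewrite G0 // !ltW.
Qed.

Lemma arc_band_ge0 x : a <= x <= b -> exists z : R[i],
  [/\ unitc z, complex.Re z = x & 0 <= arc_fun (band_alpha a b) (band_beta a b) z].
Proof.
move=> /andP[ax xb]; have xB : -1 <= x <= 1 by rewrite (le_trans a1) ?(le_trans xb).
have cx : cos (acos x) = x by rewrite acosK // in_itv.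
(* The arc lies in the lower half circle, so the point above [x] is [e^(-i acos x)]. *)
exists (Complex x (- sin (acos x))); split=> //.
  rewrite /unitc /Num.conj /=; simpc; congr Complex; last by ring.
  by rewrite -[RHS](cos2Dsin2 (acos x)) cx; ring.
rewrite /band_alpha /band_beta /expi.
set A := acos a; set B := acos b; set X := acos x in cx *.
have -> : (2^-1)%:C%C * Complex (cos (A / 2 + B / 2)) (sin (A / 2 + B / 2)) =
    Complex (cos (A / 2 + B / 2) / 2) (sin (A / 2 + B / 2) / 2).
  by simpc; congr Complex; rewrite mulrC.
rewrite arc_funE ler0c -{1}cx mulrN opprK -cosB.
(* The weight is [cos (p - q) - cos (p + q) = 2 sin p sin q], with [p] and [q] in [[0, pi]]. *)
set p := (A - X) / 2; set q := (X - B) / 2.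
have -> : A / 2 + B / 2 - X = p - q by rewrite /p /q; field.
have -> : A / 2 - B / 2 = p + q by rewrite /p /q; field.
rewrite cosB cosD (_ : _ - _ = 2 * (sin p * sin q)); last by ring.
have XA : X <= A by rewrite ler_acos // (le_trans xb).
have BX : B <= X by rewrite ler_acos // (le_trans a1).
have [B0 Api] := conj (acos_ge0 bB : 0 <= B) (acos_lepi aB : A <= pi).
by rewrite !mulr_ge0 // sin_ge0_pi //; apply/andP; rewrite /p /q; split; lra.
Qed.

End Bands.

(** * The weighted norm *)

Section WeightedNorm.
Variable R : realType.
Variables (L : nat) (a b : 'I_L.+1 -> R) (Sigma Omega : {poly R}).
Hypothesis ab : forall l, a l < b l.
Hypothesis Sigma_gt0 : forall l x, a l <= x <= b l -> 0 < Sigma.[x].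
Hypothesis Omega_gt0 : forall l x, a l <= x <= b l -> 0 < Omega.[x].
Let w x := Sigma.[x] / Omega.[x].
Let K := bands a b.

(** Multiplication by [Sigma > 0] clears the quotient [Omega P / Sigma], and the two signs encode
    the absolute value. *)
Lemma weighted_le (P : {poly R}) l x c : a l <= x <= b l ->
  (`|P.[x] / w x| <= c) <->
  forall s : bool, 0 <= (c *: Sigma + (-1) ^+ s *: (Omega * P)).[x].
Proof.
move=> xl; have S0 := Sigma_gt0 xl; have O0 := Omega_gt0 xl.
have -> : P.[x] / w x = (Omega.[x] * P.[x]) / Sigma.[x].
  by rewrite /w; field; rewrite !gt_eqF.
rewrite normrM normfV (gtr0_norm S0) ler_pdivrMr // ler_norml.
split=> [/andP[lo up] []|h].
- by rewrite expr1 scaleN1r !hornerE; lra.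
- by rewrite expr0 scale1r !hornerE; lra.
have := h true; have := h false.
rewrite expr0 expr1 scale1r scaleN1r !hornerE => h1 h2.
by apply/andP; split; lra.
Qed.

(** The supremum in [wnorm] bounds the values only when they are bounded; here continuity on each of
    finitely many compact bands ensures it. *)
Lemma has_ubound_weighted (P : {poly R}) :
  has_ubound [set `|P.[x] / w x| | x in K].
Proof.
have bound l : exists m, forall x, a l <= x <= b l -> `|P.[x] / w x| <= m.
  have [|m _ fm] := @EVT_max R (fun x => `|P.[x] / w x|) _ _ (ltW (ab l)).
    apply: continuous_in_subspaceT => x; rewrite inE /= in_itv /= => xl.
    apply: cvg_norm; apply: cvgM; first exact: continuous_horner.
    apply: cvgV.
      by rewrite mulf_neq0 ?invr_eq0 ?gt_eqF // (Sigma_gt0 xl, Omega_gt0 xl).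
    apply: cvgM; first exact: continuous_horner.
    apply: cvgV; first by rewrite gt_eqF // (Omega_gt0 xl).
    exact: continuous_horner.
  by exists `|P.[m] / w m| => x xl; apply: fm; rewrite in_itv.
have [f fP] := choice bound.
exists (\sum_l `|f l|) => _ [x [l _ xl] <-].
rewrite (le_trans (fP _ _ xl)) // (bigD1 l) //= (le_trans (ler_norm _)) // lerDl.
by rewrite sumr_ge0.
Qed.

Lemma wnorm_leP (P : {poly R}) c : wnorm K w P <= c <->
  forall (s : bool) l x, a l <= x <= b l ->
    0 <= (c *: Sigma + (-1) ^+ s *: (Omega * P)).[x].
Proof.
split=> [Pc s l x xl|h].
  move: s; apply/(weighted_le P c xl); apply: le_trans Pc.
  by apply: ub_le_sup; [exact: has_ubound_weighted|exists x => //; exists l].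
apply: ge_sup.
  exists `|P.[a ord0] / w (a ord0)|; exists (a ord0) => //.
  by exists ord0 => //=; rewrite lexx ltW.
by move=> _ [x [l _ xl] <-]; apply/(weighted_le P c xl) => s; exact: h xl.
Qed.

End WeightedNorm.

(** * Feasibility and optimality *)

Lemma cheb_sum_linear (R : realType) n (k : R) (p q : 'cV[R]_n) :
  cheb_sum (p + k *: q) = cheb_sum p + k *: cheb_sum q.
Proof.
rewrite /cheb_sum scaler_sumr -big_split; apply: eq_bigr => i _ /=.
by rewrite !mxE scalerDl scalerA.
Qed.

Theorem theorem2 (R : realType) (N L M : nat) (a b : 'I_L.+1 -> R)
    (Sigma Omega : {poly R})
    (sigma : 'cV[R]_M.+1) (W : 'M[R]_(M.+1, N.+1)) (T : {poly R}) :
  (0 < N)%N ->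
  a ord0 = -1 -> b ord_max = 1 ->
  (forall l, a l < b l) ->
  (forall l k : 'I_L.+1, k = l.+1 :> nat -> b l < a k) ->
  (forall l x, a l <= x <= b l -> 0 < Sigma.[x]) ->
  (forall l x, a l <= x <= b l -> 0 < Omega.[x]) ->
  M = maxn (size Sigma).-1 ((size Omega).-1 + N) ->
  Sigma = cheb_sum sigma ->
  (forall p : 'cV[R]_N.+1, Omega * cheb_sum p = cheb_sum (W *m p)) ->
  is_chebyshev_poly N (bands a b) (fun x => Sigma.[x] / Omega.[x]) T ->
  exists2 p : 'cV[R]_N.+1, T = cheb_sum p &
    exists (c : R) (Q : bool -> 'I_L.+1 -> 'M[R[i]]_M.+1)
           (Y : bool -> 'I_L.+1 -> 'M[R[i]]_M),
      sdp_minimizer a b sigma W c p Q Y.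
Proof.
case: N W => // n W _ a0 bL ab ba S0 O0 _ Se We [Tmon sT Tmin].
(* Induction down to the first band; the bound for [b] climbs to the last one. *)
have a1 l : -1 <= a l.
  have [k] := ubnP (l : nat); elim: k l => // k IH l; rewrite ltnS => lk.
  have [l0|l0] := eqVneq (l : nat) 0%N.
    by rewrite -a0 (_ : l = ord0) //; apply/val_inj.
  have lp : (l.-1 < L.+1)%N by apply: leq_ltn_trans (ltn_ord l); exact: leq_pred.
  have lE : l = (Ordinal lp).+1 :> nat by rewrite /= prednK // lt0n.
  rewrite ltW // (le_lt_trans _ (ba _ _ lE)) // (le_trans _ (ltW (ab _))) // IH //.
  by rewrite /= prednK ?lt0n.
have b1 l : b l <= 1.
  have [k] := ubnP (L - l)%N; elim: k l => // k IH l; rewrite ltnS => lk.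
  have [l0|l0] := eqVneq (l : nat) L.
    by rewrite -bL (_ : l = ord_max) //; apply/val_inj.
  have lp : (l.+1 < L.+1)%N by have := ltn_ord l; lia.
  rewrite ltW // (lt_le_trans (ba l (Ordinal lp) erefl)) // (le_trans (ltW (ab _))) //.
  by rewrite IH //=; have := ltn_ord l; lia.
have [p pE] : exists p : 'cV[R]_n.+2, T = cheb_sum p.
  by apply: cheb_sum_surj; rewrite sT.
exists p => //; pose c := wnorm (bands a b) (fun x => Sigma.[x] / Omega.[x]) T.
pose g (c' : R) (p' : 'cV[R]_n.+2) (s : bool) := c' *: sigma + (-1) ^+ s *: (W *m p').
have gE c' p' s : cheb_sum (g c' p' s) =
    c' *: Sigma + (-1) ^+ s *: (Omega * cheb_sum p').
  (* Writing zero as [sigma - sigma] lets linearity also show that the zero vector has sum 0. *)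
  rewrite /g -[c' *: _]add0r !cheb_sum_linear Se We -[0](subrr sigma) -scaleN1r.
  by rewrite cheb_sum_linear scaleN1r subrr add0r.
have rhsE c' p' s (m : 'I_M.+1) : (trig_poly (g c' p' s))`_(M + m) =
  (if m == 0%N :> nat then sigma m 0 * c' + (-1) ^+ s * (W *m p') m 0
   else 2^-1 * sigma m 0 * c' + (-1) ^+ s * (2^-1 * (W *m p') m 0))%:C%C.
  rewrite coef_trig_polyD /g; congr (_%:C)%C; rewrite !mxE.
  by case: ifP => _; ring.
(* As [c] is the weighted norm of [T], [c Sigma +- Omega T] is nonnegative on each band, and its
   representation supplies the two Gram matrices. *)
have /choice[QY QYP] (sl : bool * 'I_L.+1) : exists QY : 'M[R[i]]_M.+1 * 'M[R[i]]_M,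
    [/\ psdmx QY.1, psdmx QY.2 & forall z, unitc z ->
      reval (cheb_sum (g c p sl.1)) z = quad QY.1 z +
      arc_fun (band_alpha (a sl.2) (b sl.2)) (band_beta (a sl.2) (b sl.2)) z * quad QY.2 z].
  case: sl => s l /=.
  have [f0 [f1 [/sos_psdmx[Q psdQ QE] /sos_psdmx[Y psdY YE] fE]]] :
      wsos (arc_fun (band_alpha (a l) (b l)) (band_beta (a l) (b l))) M
        (reval (cheb_sum (g c p s))).
    apply: wsos_band => // [|x xl]; first exact: size_cheb_sum.
    rewrite gE -pE; move: s l x xl; exact/(wnorm_leP ab S0 O0).
  by exists (Q, Y); split=> //= z uz; rewrite fE // QE // YE.
have p_top : p ord_max 0 = (2 ^+ n)^-1.
  have : T`_n.+1 = 1 by move/monicP: Tmon; rewrite lead_coefE sT.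
  rewrite pE coef_cheb_sum => e; apply: (mulIf (_ : 2 ^+ n != 0 :> R)).
    by rewrite expf_neq0 // pnatr_eq0.
  by rewrite e mulVf // expf_neq0 // pnatr_eq0.
exists c, (fun s l => (QY (s, l)).1), (fun s l => (QY (s, l)).2); split.
  split=> // [s l|s l|s l m]; try by have [] := QYP (s, l).
  have [_ _ /sdp_lhs_circle e] := QYP (s, l).
  by have := e m; rewrite rhsE.
(* Optimality: the condition on the top coefficient makes [cheb_sum p'] monic of degree [n.+1], so
   by minimality of [T] it suffices to bound its weighted norm by [c']. *)
move=> c' p' Q' Y' [p'_top psdQ psdY feas].
have lead_p' : (cheb_sum p')`_n.+1 = 1.
  by rewrite coef_cheb_sum p'_top mulVf // expf_neq0 // pnatr_eq0.
have sp' : size (cheb_sum p') = n.+2.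
  apply/eqP; rewrite eqn_leq size_cheb_sum ltnNge; apply/negP => /leq_sizeP/(_ _ (leqnn _)).
  by rewrite lead_p' => /eqP; rewrite oner_eq0.
have mp' : cheb_sum p' \is monic by rewrite monicE lead_coefE sp' lead_p'.
apply: le_trans (Tmin _ mp' sp') _.
apply/(wnorm_leP ab S0 O0) => s l x xl; rewrite -gE.
(* At a point of the arc above [x], the weight and both Gram forms are nonnegative. *)
have [z [uz zx arc0]] := arc_band_ge0 (a1 l) (b1 l) (ab l) xl.
rewrite -ler0c -zx -[(_.[_])%:C%C]/(reval _ z).
rewrite (@circle_sdp_lhs _ _ (band_alpha (a l) (b l)) (band_beta (a l) (b l))
  (Q' s l) (Y' s l)) ?(proj1 (psdQ s l)) ?(proj1 (psdY s l)) //.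
  by rewrite addr_ge0 ?mulr_ge0 ?psdmx_quad_ge0.
by move=> m; rewrite rhsE; exact: feas.
Qed.
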